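(* Let $\gamma$ be the size of a string attractor for a string $S$ of length $n$ over an alphabet of size $\sigma$. Then, for every $2\le\tau\le n/\gamma$, there is a data structure of size $O(\tau\sigma\gamma\log_\tau(n/\gamma))$ words supporting rank queries on $S$ in $O(\log_\tau(n/\gamma))$ time.
   Context: A string attractor of $S\in\Sigma^n$ is a set $\Gamma\subseteq[1..n]$ such that every substring $S[i..j]$ has an occurrence $S[i'..j']=S[i..j]$ with some $j''\in\Gamma\cap[i'..j']$. $S.rank_c(i)$ is the number of occurrences of symbol $c$ in $S[1..i]$. Model: word RAM with words of $\Theta(\log n)$ bits. *)

(* Defs.v *)
From HB Require Import structures.
From mathcomp Require Import all_boot all_order all_algebra.
From mathcomp Require Import reals exp.
Set Implicit Arguments.
Unset Strict Implicit.
Unset Printing Implicit Defensive.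
Import Order.TTheory GRing.Theory Num.Theory.

(* Positions are 0-based: the ordinal p of 'I_n stands for position           *)
(* p + 1 of [1..n].                                                           *)

Local Open Scope nat_scope.

Definition substring (A : Type) (S : seq A) (i j : nat) : seq A :=
  drop i (take j.+1 S).

Definition is_attractor (A : Type) (n : nat) (S : n.-tuple A)
    (Gam : {set 'I_n}) : Prop :=
  forall i j : 'I_n, i <= j ->
  exists i' j' p : 'I_n,
    [/\ substring S i' j' = substring S i j, p \in Gam & i' <= p <= j'].

Definition rank (A : eqType) (S : seq A) (c : A) (i : nat) : nat :=
  count_mem c (take i S).

Definition logb (R : realType) (b x : R) : R := (ln x / ln b)%R.

(* Word RAM.  A word of w bits is an integer in [0, 2^w); all arithmetic is   *)
(* modulo 2^w, and x / 0 = 0, x mod 0 = x.  Memory is addressed by words.     *)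
(* Every instruction takes unit time.  A program is a fixed finite list of    *)
(* instructions, so it uses finitely many of the registers, and it does not   *)
(* depend on w.                                                               *)

Definition word (w : nat) : Type := 'I_(2 ^ w).

Definition to_word (w x : nat) : word w :=
  Ordinal (ltn_pmod x (expn_gt0 2 w : 0 < 2 ^ w)).

Inductive binop : Type :=
  opAdd | opSub | opMul | opDiv | opMod | opAnd | opOr | opXor | opShl | opShr.

Definition eval_binop (w : nat) (o : binop) (x y : word w) : word w :=
  to_word w match o with
  | opAdd => x + y
  | opSub => x + (2 ^ w - y)
  | opMul => x * y
  | opDiv => x %/ y
  | opMod => x %% y
  | opAnd => Nat.land x y
  | opOr => Nat.lor x y
  | opXor => Nat.lxor x y
  | opShl => x * 2 ^ y
  | opShr => x %/ 2 ^ y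
  end.

Inductive instr : Type :=
| Const of nat & nat                  (* Const d v   : r_d <- v              *)
| Move of nat & nat                   (* Move d a    : r_d <- r_a            *)
| Op of binop & nat & nat & nat       (* Op o d a b  : r_d <- r_a o r_b      *)
| Read of nat & nat                   (* Read d a    : r_d <- mem[r_a]       *)
| Write of nat & nat                  (* Write a b   : mem[r_a] <- r_b       *)
| Jump of nat                         (* Jump l      : goto l                *)
| JumpLt of nat & nat & nat           (* JumpLt a b l: if r_a < r_b goto l   *)
| JumpEq of nat & nat & nat           (* JumpEq a b l: if r_a = r_b goto l   *)
| Halt.

Definition program : Type := seq instr.

Record state (w : nat) : Type := State {
  pc : nat;
  regs : nat -> word w;
  memory : word w -> word w
}.

Definition update (A : eqType) (B : Type) (f : A -> B) (a : A) (b : B) : A -> B :=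
  fun x => if x == a then b else f x.

Definition fetch (w : nat) (P : program) (s : state w) : instr :=
  nth Halt P (pc s).

Definition halted (w : nat) (P : program) (s : state w) : Prop :=
  fetch P s = Halt.

Definition step (w : nat) (P : program) (s : state w) : state w :=
  let r := regs s in
  let m := memory s in
  let next := (pc s).+1 in
  match fetch P s with
  | Const d v => State next (update r d (to_word w v)) m
  | Move d a => State next (update r d (r a)) m
  | Op o d a b => State next (update r d (eval_binop o (r a) (r b))) m
  | Read d a => State next (update r d (m (r a))) m
  | Write a b => State next r (update m (r a) (r b))
  | Jump l => State l r m
  | JumpLt a b l => State (if r a < r b then l else next) r m
  | JumpEq a b l => State (if r a == r b then l else next) r m
  | Halt => s
  end.

(* The data structure occupies the cells 0, ..., size D - 1; nothing is said  *)
(* about the other cells.                                                     *)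
Definition stores (w : nat) (m : word w -> word w) (D : seq (word w)) : Prop :=
  forall a : word w, a < size D -> m a = nth (to_word w 0) D a.

Definition query_state (w x y : nat) (m : word w -> word w) : state w :=
  State 0 (fun r => to_word w (nth 0 [:: x; y] r)) m.

(* The query (c, i) is passed in registers 0 and 1, the answer is returned in *)
(* register 0.  The cells outside D are arbitrary work space, and D must      *)
(* be intact at the end, so that any sequence of queries can be answered.     *)
Definition supports_rank (w : nat) (P : program) (D : seq (word w))
    (sigma n : nat) (S : n.-tuple 'I_sigma) (T : nat) : Prop :=
  forall (c : 'I_sigma) (i : nat) (m : word w -> word w),
    1 <= i <= n -> stores m D ->
    exists t : nat, t <= T /\
      let s := iter t (step P) (query_state c i m) in
      [/\ halted P s, stores (memory s) D & regs s 0 = rank S c i :> nat].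

(* Main.v *)
Require Import Defs.
From mathcomp Require Import all_boot all_order all_algebra.
From mathcomp Require Import boolp reals exp.
From mathcomp Require Import zify lra.
Set Implicit Arguments.
Unset Strict Implicit.
Unset Printing Implicit Defensive.
Import Order.TTheory GRing.Theory Num.Theory.
Local Open Scope nat_scope.

(* Let t = floor tau and let L be least with n <= gamma * t ^ L.  Cut S into at
   most gamma blocks of length t ^ L (level 0); at level l.+1, cut the
   neighbourhood of radius t ^ (L - l) of every attractor position into blocks of
   length t ^ (L - l.+1).  A block of level l < L has a copy crossing an attractor
   position, so a position x in the block has a copy x' covered by level l.+1, and
   rank x - rank x' is the same for all x in the block; it is stored, for every
   symbol, with the block.  A query follows the copies down to level L, where
   blocks have length 1 and the rank is stored, and sums the differences. *)

(** * Ranks inside substrings and copies crossing an attractor position *)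

Lemma rank_substring (A : eqType) (S : seq A) (c : A) (i j x : nat) :
  i <= x <= j ->
  rank S c x.+1 = rank S c i + count_mem c (take (x.+1 - i) (substring S i j)).
Proof.
move=> /andP[ix xj]; rewrite /rank /substring -{1}(cat_take_drop i (take x.+1 S)).
rewrite count_cat take_takel; last exact: leqW.
by rewrite take_drop subnK ?(leqW ix) // take_takel.
Qed.

Lemma size_substring (A : Type) (S : seq A) (i j : nat) :
  j < size S -> size (substring S i j) = j.+1 - i.
Proof. by move=> jS; rewrite size_drop size_takel. Qed.

(* [st - sh, st - sh + len) is a block that may stick out of the string on
   either side; [sh] keeps its left end expressible in nat.  The witness q holds
   the index of an attractor position inside the copy, the increment from an
   offset in the block to one in the window starting 2 * len before that position,
   the start of the clipped block and the start of its copy. *)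
Lemma attractor_copy (A : eqType) (n : nat) (S : n.-tuple A) (Gam : {set 'I_n})
    (sh st len : nat) :
  is_attractor S Gam ->
  exists q : nat * nat * (nat * nat), forall x y, x < n -> x + sh = st + y -> y < len ->
    [/\ q.1.1 < #|Gam|, y + q.1.2 < 3 * len, q.2.2 <= n
      & exists x', [/\ x' < n,
        x' + 2 * len = nth 0 [seq val p | p <- enum Gam] q.1.1 + (y + q.1.2)
      & forall c, rank S c x.+1 + rank S c q.2.2 = rank S c x'.+1 + rank S c q.2.1]].
Proof.
move=> attr; set a := st - sh; set b := minn n (st + len - sh).
have [ab|ba] := ltnP a b; last first.
  (* The clipped block is empty, so no [x] satisfies the premises. *)
  by exists (0, 0, (0, 0)) => x y; rewrite /a /b in ba *; lia.
have an : a < n by rewrite /a /b in ab *; lia.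
have bn : b.-1 < n by rewrite /a /b in ab *; lia.
have ab1 : a <= b.-1 by lia.
have [i [j [p [/= eqS pG /andP[ip pj]]]]] := attr (Ordinal an) (Ordinal bn) ab1.
have szE : j.+1 - i = b.-1.+1 - a.
  by have := congr1 size eqS; rewrite !size_substring ?size_tuple.
(* The subtraction does not truncate: [p < i + len] and [sh + a < st + len]. *)
exists (index p (enum Gam), i + 2 * len + st - (sh + a + p), (a : nat, i : nat)) => x y xn xy ylen.
have idx : index p (enum Gam) < size (enum Gam) by rewrite index_mem mem_enum.
have [[jn i_n] p_n] := (ltn_ord j, ltn_ord i, ltn_ord p).
split => /=.
- by rewrite cardE.
- by rewrite /a /b in szE ab *; lia.
- by rewrite ltnW.
have attE : nth 0 [seq val z | z <- enum Gam] (index p (enum Gam)) = p.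
  by rewrite (nth_map p) // nth_index ?mem_enum.
rewrite attE; exists (i + (x - a)); split.
- by rewrite /a /b in szE ab *; lia.
- by rewrite /a /b in szE ab *; lia.
move=> c; rewrite (@rank_substring _ S c a b.-1 x); last by rewrite /a /b in ab *; lia.
rewrite (@rank_substring _ S c i j (i + (x - a))); last by rewrite /a /b in szE ab *; lia.
rewrite eqS; have -> : (i + (x - a)).+1 - i = x.+1 - a by rewrite /a /b in ab *; lia.
lia.
Qed.

(** * Word arithmetic and the query program *)

Lemma to_word_val (w x : nat) : x < 2 ^ w -> to_word w x = x :> nat.
Proof. exact: modn_small. Qed.

Lemma to_word_eqmod (w x y : nat) : x = y %[mod 2 ^ w] -> to_word w x = to_word w y.
Proof. by move=> xy; apply: val_inj. Qed.

Lemma opAdd_to_word (w x y : nat) :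
  eval_binop opAdd (to_word w x) (to_word w y) = to_word w (x + y).
Proof. by apply: to_word_eqmod; rewrite /= modnDm. Qed.

Lemma opMul_to_word (w x y : nat) :
  eval_binop opMul (to_word w x) (to_word w y) = to_word w (x * y).
Proof. by apply: to_word_eqmod; rewrite /= modnMm. Qed.

Lemma opDiv_to_word (w x y : nat) : x < 2 ^ w -> y < 2 ^ w ->
  eval_binop opDiv (to_word w x) (to_word w y) = to_word w (x %/ y).
Proof. by move=> xw yw; rewrite /eval_binop !to_word_val. Qed.

Lemma opMod_to_word (w x y : nat) : x < 2 ^ w -> y < 2 ^ w ->
  eval_binop opMod (to_word w x) (to_word w y) = to_word w (x %% y).
Proof. by move=> xw yw; rewrite /eval_binop !to_word_val. Qed.

Lemma opSub_to_word (w x y : nat) : x < 2 ^ w -> y <= x ->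
  eval_binop opSub (to_word w x) (to_word w y) = to_word w (x - y).
Proof.
move=> xw yx; have yw := leq_ltn_trans yx xw.
rewrite /eval_binop !to_word_val //; apply: to_word_eqmod.
by have -> : x + (2 ^ w - y) = x - y + 2 ^ w; [lia | rewrite modnDr].
Qed.

Lemma stores_mkseq (w N : nat) (cell : nat -> nat) (m : word w -> word w) (a : nat) :
  stores m (mkseq (fun a => to_word w (cell a)) N) -> a < N -> a < 2 ^ w ->
  m (to_word w a) = to_word w (cell a).
Proof.
move=> st aN aw.
by rewrite st ?size_mkseq to_word_val // nth_mkseq.
Qed.

(* Registers: 0 symbol, 1 offset in the current array of blocks, 2 block length,
   3 arity t, 4 record size, 5 the constant 1, 6 address of the array, 7 partial
   answer, 8 and 9 scratch.  The loop starts at instruction 7. *)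
Definition rank_program : program :=
  [:: Const 5 1; Read 2 2; Read 3 5; Const 6 2; Read 4 6; Const 6 3;
      Op opSub 1 1 5;
      Op opDiv 8 1 2; Op opMod 1 1 2; Op opMul 8 8 4; Op opAdd 8 8 6;
      Read 6 8; Op opAdd 8 8 5; Read 9 8; Op opAdd 1 1 9;
      Op opAdd 8 8 5; Op opAdd 8 8 0; Read 9 8; Op opAdd 7 7 9;
      JumpEq 2 5 22; Op opDiv 2 2 3; Jump 7;
      Move 0 7; Halt].

(** For [M = 2 ^ w], [a + (M - b)] is the stored form of the possibly negative rank difference
    [a - b]. *)
Lemma addn_subn_swap (M a b p q : nat) :
  b <= M -> p + b = q + a -> a + (M - b) + q = p + M.
Proof. lia. Qed.

(** * Symbolic execution, one instruction at a time *)

Section Run.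
Variables (w : nat) (P : program) (m : word w -> word w) (s : state w).
Implicit Types (rg : nat -> word w) (T k d a b l v : nat).

Lemma run_const T k d v rg :
  nth Halt P k = Const d v ->
  iter T (step P) (State k.+1 (update rg d (to_word w v)) m) = s ->
  iter T.+1 (step P) (State k rg m) = s.
Proof. by move=> Pk; rewrite iterSr /step /fetch Pk. Qed.

(** Operands and result enter through equations, so that values are simplified to [to_word] form at
    every step. *)
Lemma run_op T k o d a b rg x y z :
  nth Halt P k = Op o d a b -> rg a = x -> rg b = y -> eval_binop o x y = z ->
  iter T (step P) (State k.+1 (update rg d z) m) = s ->
  iter T.+1 (step P) (State k rg m) = s.
Proof. by move=> Pk <- <- <-; rewrite iterSr /step /fetch Pk. Qed.

Lemma run_read T k d a rg x y :
  nth Halt P k = Read d a -> rg a = x -> m x = y ->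
  iter T (step P) (State k.+1 (update rg d y) m) = s ->
  iter T.+1 (step P) (State k rg m) = s.
Proof. by move=> Pk <- <-; rewrite iterSr /step /fetch Pk. Qed.

Lemma run_move T k d a rg x :
  nth Halt P k = Move d a -> rg a = x ->
  iter T (step P) (State k.+1 (update rg d x) m) = s ->
  iter T.+1 (step P) (State k rg m) = s.
Proof. by move=> Pk <-; rewrite iterSr /step /fetch Pk. Qed.

Lemma run_jump T k l rg :
  nth Halt P k = Jump l ->
  iter T (step P) (State l rg m) = s -> iter T.+1 (step P) (State k rg m) = s.
Proof. by move=> Pk; rewrite iterSr /step /fetch Pk. Qed.

Lemma run_jumpeq T k a b l rg x y :
  nth Halt P k = JumpEq a b l -> rg a = x -> rg b = y ->
  iter T (step P) (State (if x == y then l else k.+1) rg m) = s ->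
  iter T.+1 (step P) (State k rg m) = s.
Proof. by move=> Pk <- <-; rewrite iterSr /step /fetch Pk. Qed.

End Run.

(** * The block tree and its table *)

Section BlockTree.
Variables (w n sigma : nat) (S : n.-tuple 'I_sigma) (Gam : {set 'I_n}) (t L : nat).
Local Notation gamma := #|Gam|.

(** Indices are mixed-radix: for [l > 0], [r = (l * gamma + a) * (3 * t) + b] is block [b] around
    attractor position number [a] at level [l]. On level 0, [r] numbers consecutive blocks. *)
Definition level (r : nat) : nat := r %/ (3 * t) %/ gamma.

Definition block_length (l : nat) : nat := t ^ (L - l).

(* Block r starts at position block_start r - block_shift r, which may be
   negative.  The blocks of level l.+1 around an attractor position p cover
   [p - 2 * len, p + len) where len is the block length of level l; copies lie in
   [p - len, p + len), and the slack makes all offset increments nonnegative. *)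
Definition block_start (r : nat) : nat :=
  if level r == 0 then r * block_length 0
  else nth 0 [seq val p | p <- enum Gam] (r %/ (3 * t) %% gamma)
       + r %% (3 * t) * block_length (level r).

Definition block_shift (r : nat) : nat :=
  if level r == 0 then 0 else 2 * block_length (level r).-1.

Definition num_blocks : nat := L.+1 * gamma * (3 * t).

(** Symbols become numbers because [cell] decodes the symbol from an address. *)
Definition srank (c p : nat) : nat := rank [seq val s | s <- S] c p.

Lemma srankE (c : 'I_sigma) (p : nat) : srank c p = rank S c p.
Proof.
rewrite /srank /rank -map_take count_map; apply: eq_count => s /=.
exact: val_eqE.
Qed.

(** Address of the array around the copy's attractor position, offset increment, then one count per
    symbol. *)
Definition record_size := sigma + 2.

Section Cells.
Variable copy : nat -> nat * nat * (nat * nat).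

(* The count fields hold differences modulo 2 ^ w; at the last level, where
   blocks have length 1, they hold the rank itself. *)
Definition cell (a : nat) : nat :=
  match a with
  | 0 => block_length 0
  | 1 => t
  | 2 => record_size
  | a'.+3 =>
    let r := a' %/ record_size in
    let q := copy r in
    match a' %% record_size with
    | 0 => 3 + ((level r).+1 * gamma + q.1.1) * (3 * t) * record_size
    | 1 => q.1.2
    | c.+2 =>
      if level r == L then srank c (block_start r - block_shift r).+1
      else srank c q.2.1 + (2 ^ w - srank c q.2.2)
    end
  end.

Definition table : seq (word w) :=
  mkseq (fun a => to_word w (cell a)) (3 + num_blocks * record_size).

Lemma cell_record (r f : nat) : f < record_size ->
  cell (r * record_size + f).+3 =
    match f with
    | 0 => 3 + ((level r).+1 * gamma + (copy r).1.1) * (3 * t) * record_size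
    | 1 => (copy r).1.2
    | c.+2 =>
      if level r == L then srank c (block_start r - block_shift r).+1
      else srank c (copy r).2.1 + (2 ^ w - srank c (copy r).2.2)
    end.
Proof.
move=> frs; have rs0 : 0 < record_size by rewrite /record_size addn2.
by rewrite /cell divnMDl // divn_small // addn0 modnMDl modn_small.
Qed.

(* r is the block reached and x the current copy of the queried position; what
   remains to be added to the partial answer is the rank of x. *)
Definition at_loop (c : 'I_sigma) (ans : nat) (rg : nat -> word w) (l : nat) : Prop :=
  exists x rb u acc : nat,
    let r := rb + u %/ block_length l in
    [/\ [/\ rg 0 = to_word w c, rg 2 = to_word w (block_length l),
        rg 3 = to_word w t, rg 4 = to_word w record_size
        & rg 5 = to_word w 1],
      [/\ rg 1 = to_word w u, rg 6 = to_word w (3 + rb * record_size)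
        & rg 7 = to_word w acc],
      [/\ u < 2 ^ w, r < num_blocks, level r = l, x < n
        & x + block_shift r = block_start r + u %% block_length l]
      & acc + srank c x.+1 = ans %[mod 2 ^ w]].

Hypothesis copyP : forall r x y : nat,
  x < n -> x + block_shift r = block_start r + y -> y < block_length (level r) ->
  [/\ (copy r).1.1 < gamma, y + (copy r).1.2 < 3 * block_length (level r),
      (copy r).2.2 <= n
    & exists x', [/\ x' < n,
        x' + 2 * block_length (level r) =
          nth 0 [seq val p | p <- enum Gam] (copy r).1.1 + (y + (copy r).1.2)
      & forall c : 'I_sigma,
          srank c x.+1 + srank c (copy r).2.2
          = srank c x'.+1 + srank c (copy r).2.1]].

Hypothesis t_gt1 : 1 < t.
Hypothesis table_fits : 3 + num_blocks * record_size <= 2 ^ w.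
Hypothesis length_fits : 3 * block_length 0 <= 2 ^ w.
Hypothesis n_fits : n < 2 ^ w.

Lemma srank_le (c p : nat) : srank c p <= n.
Proof.
apply: (leq_trans (count_size _ _)).
by rewrite size_take size_map size_tuple; case: ltnP => // /ltnW.
Qed.

Let block_length_gt0 l : 0 < block_length l.
Proof. by rewrite expn_gt0 ltnW. Qed.

Let block_length_le l : block_length l <= block_length 0.
Proof. by rewrite leq_exp2l // leq_sub2l. Qed.

Lemma num_blocks_fit r f : r < num_blocks -> f < record_size ->
  (r * record_size + f).+3 < 3 + num_blocks * record_size.
Proof.
move=> rN fs; have := leq_mul rN (leqnn record_size); rewrite mulSn; lia.
Qed.

(** * Correctness and running time of a query *)

Lemma table_read (m : word w -> word w) (r f : nat) :
  stores m table -> r < num_blocks -> f < record_size ->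
  m (to_word w (r * record_size + f).+3) = to_word w (cell (r * record_size + f).+3).
Proof.
move=> st rN fs; have fit := num_blocks_fit rN fs.
by rewrite (stores_mkseq st) //; exact: leq_trans table_fits.
Qed.

(** The straight-line instructions before the exit test; leaving [cell] unevaluated makes this serve
    the last level and all others. *)
Lemma loop_body (c : 'I_sigma) (m : word w -> word w) (rg : nat -> word w)
    (l rb u acc : nat) :
  let r := rb + u %/ block_length l in
  let y := u %% block_length l in
  stores m table ->
  rg 0 = to_word w c -> rg 2 = to_word w (block_length l) ->
  rg 3 = to_word w t -> rg 4 = to_word w record_size -> rg 5 = to_word w 1 ->
  rg 1 = to_word w u -> rg 6 = to_word w (3 + rb * record_size) ->
  rg 7 = to_word w acc ->
  u < 2 ^ w -> r < num_blocks ->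
  exists rg',
    [/\ iter 12 (step rank_program) (State 7 rg m) = State 19 rg' m,
      [/\ rg' 0 = to_word w c, rg' 2 = to_word w (block_length l),
        rg' 3 = to_word w t, rg' 4 = to_word w record_size
        & rg' 5 = to_word w 1]
    & [/\ rg' 1 = to_word w (y + cell (r * record_size + 1).+3),
        rg' 6 = to_word w (cell (r * record_size + 0).+3)
      & rg' 7 = to_word w (acc + cell (r * record_size + c.+2).+3)]].
Proof.
move=> r y st r0 r2 r3 r4 r5 r1 r6 r7 uw rN.
have lw : block_length l < 2 ^ w.
  by apply: leq_trans length_fits; have := block_length_le l; have := block_length_gt0 0; lia.
have csz : c.+2 < record_size by rewrite /record_size addn2 !ltnS.
have R0 := table_read st rN (ltn_trans (ltn0Sn _) csz).
have R1 := @table_read m r 1 st rN (leq_ltn_trans (ltn0Sn _) csz).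
have R2 := table_read st rN csz.
have eA : u %/ block_length l * record_size + (3 + rb * record_size)
  = (r * record_size + 0).+3 by rewrite /r; lia.
eexists; split.
- apply: run_op; [reflexivity | exact: r1 | exact: r2 | exact: opDiv_to_word | ].
  apply: run_op; [reflexivity | exact: r1 | exact: r2 | exact: opMod_to_word | ].
  apply: run_op; [reflexivity | reflexivity | exact: r4 | exact: opMul_to_word | ].
  apply: run_op; [reflexivity | reflexivity | exact: r6
    | rewrite opAdd_to_word eA; reflexivity | ].
  apply: run_read; [reflexivity | reflexivity | exact: R0 | ].
  apply: run_op; [reflexivity | reflexivity | exact: r5
    | rewrite opAdd_to_word addn1 -addnS; reflexivity | ].
  apply: run_read; [reflexivity | reflexivity | exact: R1 | ].
  apply: run_op; [reflexivity | reflexivity | reflexivity | exact: opAdd_to_word | ].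
  apply: run_op; [reflexivity | reflexivity | exact: r5
    | rewrite opAdd_to_word addn1 -addnS; reflexivity | ].
  apply: run_op; [reflexivity | reflexivity | exact: r0
    | rewrite opAdd_to_word !addSn -addnA (addnC 2) addn2; reflexivity | ].
  apply: run_read; [reflexivity | reflexivity | exact: R2 | ].
  apply: run_op; [reflexivity | exact: r7 | reflexivity | exact: opAdd_to_word | ].
  reflexivity.
- by split.
- by split.
Qed.

(** The window around the attractor position has length [3 * block_length l], that is, [3 * t]
    blocks of the next level; so dividing the new offset by the new length selects a block around
    that same position. *)
Lemma descend (r x y : nat) :
  let l := level r in
  let rb := (l.+1 * gamma + (copy r).1.1) * (3 * t) in
  let u := y + (copy r).1.2 in
  let r' := rb + u %/ block_length l.+1 in
  x < n -> x + block_shift r = block_start r + y -> y < block_length l -> l < L ->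
  exists x',
    [/\ u < 2 ^ w, r' < num_blocks, level r' = l.+1, x' < n
      & x' + block_shift r' = block_start r' + u %% block_length l.+1] /\
    forall c : 'I_sigma,
      srank c (copy r).2.1 + (2 ^ w - srank c (copy r).2.2) + srank c x'.+1
      = srank c x.+1 + 2 ^ w.
Proof.
move=> l rb u r' xn pos yl lltL.
have [g_lt u_lt pb_le [x' [x'n pos' cnt]]] := copyP xn pos yl.
rewrite -/l -/u in u_lt pos'.
have lenS : block_length l = t * block_length l.+1.
  by rewrite /block_length -expnS subnSK.
pose b := u %/ block_length l.+1.
have t3 : 0 < 3 * t by rewrite muln_gt0 /= (ltnW t_gt1).
have gamma0 : 0 < gamma := leq_ltn_trans (leq0n _) g_lt.
have b_lt : b < 3 * t by rewrite ltn_divLR // -mulnA -lenS.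
have r'div : r' %/ (3 * t) = l.+1 * gamma + (copy r).1.1.
  by rewrite /r' /rb divnMDl // divn_small // addn0.
have r'mod : r' %% (3 * t) = b by rewrite /r' /rb modnMDl modn_small.
have lr' : level r' = l.+1.
  by rewrite /level r'div divnMDl // divn_small // addn0.
exists x'; split; first split=> //.
- by apply: leq_trans u_lt _; apply: leq_trans length_fits; rewrite leq_mul2l block_length_le.
- rewrite /num_blocks -ltn_divLR // r'div.
  apply: (@leq_trans (l.+2 * gamma)); last by rewrite leq_mul2r ltnS lltL orbT.
  by rewrite [leqRHS]mulSn addnC ltn_add2r.
- rewrite /block_shift /block_start lr' /= r'div r'mod modnMDl modn_small //.
  by rewrite pos' -addnA -divn_eq.
move=> c; apply: addn_subn_swap (cnt c).
exact: leq_trans (srank_le _ _) (ltnW n_fits).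
Qed.

(** Induction on the number [d] of levels left. A round takes 12 instructions plus test, division
    and jump; the last one takes 14 in all. *)
Lemma loop_run (c : 'I_sigma) (ans : nat) (m : word w -> word w) (d l : nat)
    (rg : nat -> word w) :
  stores m table -> l + d = L -> at_loop c ans rg l ->
  exists T rg',
    [/\ T <= 15 * d.+1, iter T (step rank_program) (State 7 rg m) = State 23 rg' m
      & rg' 0 = to_word w ans].
Proof.
move=> st; elim: d l rg => [|d IH] l rg lL
  [x [rb [u [acc [[r0 r2 r3 r4 r5] [r1 r6 r7] [uw rN lr xn pos] inv]]]]];
  have [rg1 [run1 [s0 s2 s3 s4 s5] [s1 s6 s7]]] :=
    loop_body st r0 r2 r3 r4 r5 r1 r6 r7 uw rN;
  set r := rb + _ in rN lr pos s1 s6 s7; set y := u %% _ in pos s1.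
- have lE : l = L by rewrite -lL addn0.
  have len1 : block_length l = 1 by rewrite lE /block_length subnn.
  have s7E : rg1 7 = to_word w ans.
    rewrite s7 cell_record; last by rewrite /record_size addn2 !ltnS.
    rewrite lr lE eqxx; have -> : block_start r - block_shift r = x.
      by move: pos; rewrite /y len1 modn1 addn0 => <-; rewrite addnK.
    exact: to_word_eqmod.
  eexists 14, _; split; [by [] | | ].
- rewrite (iterD 2 12) run1.
  apply: run_jumpeq; [reflexivity | exact: s2 | exact: s5 | rewrite len1 eqxx].
  by apply: run_move; [reflexivity | exact: s7E | reflexivity].
- by [].
have lltL : l < L by rewrite -lL addnS ltnS leq_addr.
have lenS : block_length l = t * block_length l.+1.
  by rewrite /block_length -expnS subnSK.
have csz : c.+2 < record_size by rewrite /record_size addn2 !ltnS.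
have al : at_loop c ans (update rg1 2 (to_word w (block_length l.+1))) l.+1.
  clear run1 IH; rewrite -lr in lltL.
  have [] := descend xn pos _ lltL; first by rewrite lr ltn_mod.
  move=> x' [index' cnt]; rewrite lr in index' cnt lltL.
  rewrite !cell_record ?lr ?(ltn_eqF lltL) in s1 s6 s7; try by apply: leq_ltn_trans csz.
  eexists x', _, _, _; split; [by split | split; [exact: s1 | exact: s6 | exact: s7] | exact: index' | ].
  by rewrite -inv -addnA cnt addnA modnDr.
have [T [rg' [Tle run' ans']]] := IH _ _ (etrans (addSnnS l d) lL) al.
have lw : block_length l < 2 ^ w.
  apply: leq_trans length_fits.
  by have := block_length_le l; have := block_length_gt0 0; lia.
have tw : t < 2 ^ w.
  by apply: leq_ltn_trans lw; rewrite lenS leq_pmulr.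
(* The program recognises the last level by block length 1, so earlier blocks must be longer. *)
have one_lt : 1 < block_length l.
  by rewrite lenS (leq_trans t_gt1) // leq_pmulr.
have eD : eval_binop opDiv (to_word w (block_length l)) (to_word w t)
    = to_word w (block_length l.+1).
  by rewrite opDiv_to_word // lenS mulKn // ltnW.
have eJ : (to_word w (block_length l) == to_word w 1) = false.
  by rewrite -val_eqE /= !modn_small ?gtn_eqF // (ltn_trans one_lt lw).
exists (T.+3 + 12), rg'; split; [lia | | exact: ans'].
rewrite iterD run1.
apply: run_jumpeq; [reflexivity | exact: s2 | exact: s5 | rewrite eJ].
apply: run_op; [reflexivity | exact: s2 | exact: s3 | exact: eD | ].
by apply: run_jump; [reflexivity | exact: run'].
Qed.

Lemma table_supports_rank :
  n <= gamma * t ^ L ->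
  supports_rank rank_program table S (7 + 15 * L.+1).
Proof.
move=> nL c i m /andP[i0 in_] st.
have gamma0 : 0 < gamma by move: nL; case: (gamma) => //; lia.
have hdr a : a < 3 -> m (to_word w a) = to_word w (cell a).
  move=> a3; have aN : a < 3 + num_blocks * record_size by apply: ltn_addr.
  by rewrite (stores_mkseq st) //; exact: leq_trans table_fits.
have iw : i < 2 ^ w by apply: leq_ltn_trans in_ n_fits.
have [rg [run0 al]] : exists rg,
    iter 7 (step rank_program) (query_state c i m) = State 7 rg m
    /\ at_loop c (rank S c i) rg 0.
  eexists; split.
    apply: run_const; [reflexivity | ].
    apply: run_read; [reflexivity | reflexivity | exact: (hdr 0) | ].
    apply: run_read; [reflexivity | reflexivity | exact: (hdr 1) | ].
    apply: run_const; [reflexivity | ].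
    apply: run_read; [reflexivity | reflexivity | exact: (hdr 2) | ].
    apply: run_const; [reflexivity | ].
    apply: run_op; [reflexivity | reflexivity | reflexivity | exact: opSub_to_word | ].
    reflexivity.
  have rlt : i.-1 %/ block_length 0 < gamma.
    by rewrite ltn_divLR // /block_length subn0 prednK // (leq_trans in_).
  have lev0 : level (i.-1 %/ block_length 0) = 0.
    rewrite /level divn_small //; apply: leq_ltn_trans rlt; exact: leq_div.
  (* [rank S c i] counts up to and including the 0-based position [i.-1]. The partial answer in
     register 7 starts at 0, the initial value of registers beyond the query. *)
  exists i.-1, 0, i.-1, 0; split.
  - by split.
  - by split; rewrite ?mul0n ?addn0 /update /= ?subn1.
  - rewrite !add0n; split=> //.
    + by apply: leq_ltn_trans iw; exact: leq_pred.
    + by apply: leq_trans rlt _; rewrite /num_blocks -mulnA mulnCA leq_pmulr // !muln_gt0 /= ltnW.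
    + by rewrite prednK.
    + by rewrite /block_shift /block_start lev0 /= addn0 -divn_eq.
  - by rewrite add0n prednK // srankE.
have [T [rg' [Tle run' ans]]] := loop_run st (add0n L) al.
exists (T + 7); split; first by rewrite addnC leq_add2l.
rewrite iterD run0 run' /=; split=> //.
rewrite ans to_word_val //; apply: leq_ltn_trans n_fits.
by rewrite -srankE srank_le.
Qed.

End Cells.
End BlockTree.

(** * From an attractor to a data structure that fits the word size *)

Lemma block_tree_supports_rank (w n sigma : nat) (S : n.-tuple 'I_sigma)
    (Gam : {set 'I_n}) (t L : nat) :
  is_attractor S Gam -> 1 < t -> n <= #|Gam| * t ^ L ->
  3 + num_blocks Gam t L * record_size sigma <= 2 ^ w ->
  3 * block_length t L 0 <= 2 ^ w -> n < 2 ^ w ->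
  exists D : seq (word w),
    size D = 3 + num_blocks Gam t L * record_size sigma /\
    supports_rank rank_program D S (7 + 15 * L.+1).
Proof.
move=> attr t_gt1 nL table_fits length_fits n_fits.
have [copy copyP] := choice (fun r => attractor_copy (block_shift Gam t L r)
  (block_start Gam t L r) (block_length t L (level Gam t r)) attr).
exists (table w S Gam t L copy); split; first by rewrite size_mkseq.
apply: table_supports_rank => // r x y xn pos yl.
have [g_lt u_lt pb_le [x' [x'n pos' cnt]]] := copyP r x y xn pos yl.
split=> //; exists x'; split=> // c; by rewrite !srankE.
Qed.

(** With [M = maxn n sigma >= 2], the table has at most [3 + 12 * M ^ 3 <= 32 * M ^ 3 <= M ^ 8]
    cells. *)
Lemma table_size_bound (w n sigma gamma t L : nat) :
  n ^ 8 <= 2 ^ w -> sigma ^ 8 <= 2 ^ w -> 1 < n -> 0 < gamma -> 1 < t ->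
  gamma * t <= n -> gamma * t ^ L < n ->
  [/\ 3 + L.+2 * gamma * (3 * t) * (sigma + 2) <= 2 ^ w,
      3 * t ^ L.+1 <= 2 ^ w & n < 2 ^ w].
Proof.
move=> nw sw n1 g0 t1 gt gtL.
pose M := maxn n sigma.
have Mw : M ^ 8 <= 2 ^ w by rewrite /M; case: (leqP n sigma).
have [nM sM] : n <= M /\ sigma <= M by rewrite leq_maxl leq_maxr.
have M2 : 1 < M by apply: leq_trans nM.
have Ln : L < n.
  apply: leq_ltn_trans gtL; apply: leq_trans (ltnW (ltn_expl L t1)) _.
  by rewrite leq_pmull.
have M3 : 8 <= M ^ 3 by rewrite (leq_exp2r 2 M (isT : 0 < 3)).
have M5 : 32 <= M ^ 5 by rewrite (leq_exp2r 2 M (isT : 0 < 5)).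
have p1 : L.+2 * (gamma * t) * (sigma + 2) <= 4 * (M * M * M).
  have -> : 4 * (M * M * M) = 2 * M * M * (2 * M) by lia.
  by apply: leq_mul; [apply: leq_mul|]; lia.
have p2 : t ^ L.+1 <= M * M.
  rewrite expnS; apply: leq_mul.
    by apply: leq_trans nM; apply: leq_trans gt; rewrite leq_pmull.
  by apply: leq_trans nM; apply: leq_trans (ltnW gtL); rewrite leq_pmull.
have e3 : M ^ 3 = M * M * M by rewrite !expnS expn0 muln1 mulnA.
have e8 : M ^ 8 = M ^ 5 * (M * M * M) by rewrite -e3 -expnD.
rewrite e3 in M3; have M1 : 0 < M * M * M by apply: leq_trans M3.
have MM : M * M <= M * M * M by rewrite leq_pmulr // ltnW.
have hM : 32 * (M * M * M) <= 2 ^ w.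
  by apply: leq_trans Mw; rewrite e8 leq_mul2r M5 orbT.
have rearr : L.+2 * gamma * (3 * t) * (sigma + 2)
    = 3 * (L.+2 * (gamma * t) * (sigma + 2)).
  lia.
split.
- by rewrite rearr; lia.
- lia.
- have := leq_pmull M (ltnW M2); lia.
Qed.

(** * Real estimates and the final bounds *)

Local Open Scope ring_scope.

(** Rounding [tau] down to [t] costs a factor 2, since [tau < t + 1 <= t ^ 2]. *)
Lemma logb_base_change (R : realType) (tau x : R) (t l : nat) :
  (1 < t)%N -> 2 <= tau -> tau < t.+1%:R -> t%:R ^+ l < x ->
  l%:R <= 2 * logb tau x.
Proof.
move=> t1 tau2 taut tlx.
have lnt : 0 < ln tau by rewrite ln_gt0 //; lra.
have t0 : 0 < t%:R :> R by rewrite ltr0n ltnW.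
have tl0 : 0 < t%:R ^+ l :> R by rewrite exprn_gt0.
have x0 : 0 < x by apply: lt_trans tlx.
rewrite /logb mulrA ler_pdivlMr //.
have h1 : ln tau <= 2 * ln t%:R.
  rewrite mulr_natl -lnXn // ler_ln ?posrE ?exprn_gt0 //; last by lra.
  apply: (le_trans (ltW taut)); rewrite -natrX ler_nat; nia.
have h2 : l%:R * ln t%:R <= ln x.
  by rewrite mulr_natl -lnXn // ler_ln ?posrE // ltW.
have := ler_wpM2l (ler0n R l) h1; lra.
Qed.

Theorem theorem19 (R : realType) :
  exists k : nat, forall K : nat,
  exists (P : program) (C : nat),
  forall (w n sigma gamma : nat) (S : n.-tuple 'I_sigma) (Gam : {set 'I_n})
         (tau : R),
    (n ^ k <= 2 ^ w)%N -> (sigma ^ k <= 2 ^ w)%N -> (2 ^ w <= n ^ K)%N ->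
    is_attractor S Gam -> #|Gam| = gamma ->
    2 <= tau -> tau <= n%:R / gamma%:R ->
    exists (D : seq (word w)) (T : nat),
      [/\ (size D)%:R <=
            C%:R * (tau * sigma%:R * gamma%:R * logb tau (n%:R / gamma%:R)),
          T%:R <= C%:R * logb tau (n%:R / gamma%:R)
        & supports_rank P D S T].
Proof.
(* The exponent 8 comes from [table_size_bound]; 100 exceeds the factors 39 for size and 67 for time
   that the estimates below yield. *)
exists 8%N => K; exists rank_program, 100%N.
move=> w n sigma gamma S Gam tau nw sw _ attr Ggamma tau2 taun.
have gamma0 : (0 < gamma)%N.
  (* Division by 0 yields 0, which would force [tau <= 0]. *)
  by rewrite lt0n; apply/negP => /eqP g0; move: taun; rewrite g0 invr0 mulr0; lra.
have gR : 0 < gamma%:R :> R by rewrite ltr0n.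
have tau0 : 0 <= tau by lra.
have [t [t_gt1 t_le t_gt]] : exists t : nat, [/\ (1 < t)%N, t%:R <= tau & tau < t.+1%:R].
  exists (Num.truncn tau); have /andP[? ?] := truncn_itv tau0.
  by split=> //; rewrite truncn_ge_nat.
have gtn : (gamma * t <= n)%N.
  rewrite -(ler_nat R) natrM mulrC -ler_pdivlMr //; exact: le_trans t_le taun.
have n_gt1 : (1 < n)%N by nia.
have sigma0 : (0 < sigma)%N.
  by have := tnth S (Ordinal (ltnW n_gt1)); case: (sigma) => [[]|].
have exL : exists L, (n <= gamma * t ^ L)%N.
  by exists n; have := ltn_expl n t_gt1; nia.
(* The least exponent is positive because [gamma < gamma * t <= n]; it is called [L.+1] from here
   on, and its minimality bounds [L] by the logarithm. *)
have [[|L] nL minL] := ex_minnP exL; first by rewrite expn0 muln1 in nL; nia.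
have Ln : (gamma * t ^ L < n)%N.
  by rewrite ltnNge; apply/negP => /minL; rewrite ltnn.
have [table_fits length_fits n_fits] :=
  table_size_bound nw sw n_gt1 gamma0 t_gt1 gtn Ln.
have [D [sizeD DP]] : exists D : seq (word w),
    size D = (3 + L.+2 * gamma * (3 * t) * (sigma + 2))%N /\
    supports_rank rank_program D S (7 + 15 * L.+2).
  rewrite -Ggamma in nL table_fits *.
  by apply: block_tree_supports_rank => //; rewrite /block_length subn0.
exists D, (7 + 15 * L.+2)%N.
set l := logb _ _.
have Ll : L%:R <= 2 * l.
  apply: logb_base_change t_gt1 tau2 t_gt _.
  by rewrite ltr_pdivlMr // -natrX -natrM ltr_nat mulnC.
(* Since [tau <= n / gamma], the logarithm is at least 1 and absorbs additive constants. *)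
have l1 : 1 <= l.
  have lnt : 0 < ln tau by rewrite ln_gt0 //; lra.
  have tau1 : 0 < tau by lra.
  by rewrite /l /logb ler_pdivlMr // mul1r ler_ln ?posrE // (lt_le_trans tau1).
clearbody l.
have s1 : 1 <= sigma%:R :> R by rewrite ler1n.
have g1 : 1 <= gamma%:R :> R by rewrite ler1n.
have a1 : L.+2%:R <= 4 * l.
  rewrite -[L.+2]addn2 natrD; lra.
have a2 : (sigma + 2)%:R <= 3 * sigma%:R :> R by rewrite natrD; lra.
have a3 : L.+2%:R * (sigma + 2)%:R <= 4 * l * (3 * sigma%:R) by exact: ler_pM.
have a4 : gamma%:R * t%:R <= gamma%:R * tau by rewrite ler_pM2l.
have a5 := ler_pM (mulr_ge0 (ler0n R _) (ler0n R _))
  (mulr_ge0 (ler0n R _) (ler0n R _)) a3 a4.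
have a6 : 1 <= tau * sigma%:R * gamma%:R * l.
  by rewrite !mulr_ege1 //; lra.
apply: And3 => //.
- rewrite sizeD natrD !natrM; lra.
- rewrite natrD natrM; lra.
Qed.
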